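(* Let $X$ be a dynamical system with state space in $\mathbb{R}^p$, let $\mathcal{T}=\{t_0,\dots,t_{T-1}\}$, and let $(Z=\mathbf{x}_{\mathbf{A}}(\mathcal{T})\cup \mathbf{y}_{\mathbf{A}}(\mathcal{T}),\|\cdot\|)$ and $(Z'=\mathbf{x}'_{\mathbf{A}}(\mathcal{T})\cup \mathbf{y}'_{\mathbf{A}}(\mathcal{T}),\|\cdot\|)$ be two pairs of neighboring trajectories in the state space of $X$, regarded as finite metric spaces with the Euclidean distance. Given a partition $0=\epsilon_1<\dots<\epsilon_r<\dots<\epsilon_R$ of Vietoris-Rips filtration radii, the 0-dimensional Betti curves $\beta_0^{\epsilon_r}(Z),\beta_0^{\epsilon_r}(Z'):[0,\epsilon_R]\to[0,2T]$ satisfy $$\operatorname{d_I}\big(\beta_0^{\epsilon_r}(Z),\beta_0^{\epsilon_r}(Z')\big)\le 2\operatorname{d_{GH}}(Z,Z').$$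
   Context: A dynamical system $X$ is a system modeled by $p$ differential equations for functions $X_1(\mathbf{A},t),\dots,X_p(\mathbf{A},t)$ of time $t$ and control parameters $\mathbf{A}=\{A_1,\dots,A_m\}$; its state space consists of the points $(X_1(\mathbf{A},t),\dots,X_p(\mathbf{A},t))\in\mathbb{R}^p$. A trajectory evaluated at times $\mathcal{T}=\{t_0,\dots,t_{T-1}\}$ is $\mathbf{x}_{\mathbf{A}}(\mathcal{T})=\{\mathbf{x}_{\mathbf{A}}(t_0),\dots,\mathbf{x}_{\mathbf{A}}(t_{T-1})\}\subset\mathbb{R}^p$ with $\mathbf{x}_{\mathbf{A}}(t_n)=(X_1(\mathbf{A},t_n),\dots,X_p(\mathbf{A},t_n))$. A trajectory $\mathbf{y}_{\mathbf{A}}(\mathcal{T})$ is a neighboring trajectory of $\mathbf{x}_{\mathbf{A}}(\mathcal{T})$ if $\|\mathbf{x}_{\mathbf{A}}(t_0)-\mathbf{y}_{\mathbf{A}}(t_0)\|\le\epsilon$ for an $\epsilon>0$. Vietoris-Rips complex of a point cloud $Z$ at radius $\epsilon$: $\mathcal{R}_\epsilon(Z)=\{\sigma\subset Z:\|\mathbf{z}_i-\mathbf{z}_j\|\le 2\epsilon\ \forall\,\mathbf{z}_i,\mathbf{z}_j\in\sigma\}$. $\beta_0^{\epsilon}(Z)$ is the 0-th Betti number at radius $\epsilon$, i.e. the number of 0-dimensional barcode intervals $[b,d)$ of the Vietoris-Rips filtration of $Z$ with $b\le\epsilon<d$ (equivalently the number of connected components of $\mathcal{R}_\epsilon(Z)$).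 The 0-dimensional Betti curve is the non-increasing piecewise constant function $\epsilon\mapsto\beta_0^{\epsilon}(Z)$. Interleaving distance between the 0-dimensional Betti curves: $\operatorname{d_I}(\beta_0^{\epsilon_r}(Z),\beta_0^{\epsilon_r}(Z'))=\inf\{\alpha>0:\ \beta_0^{\epsilon}(Z)\ge\beta_0^{\epsilon+\alpha}(Z')\text{ and }\beta_0^{\epsilon}(Z')\ge\beta_0^{\epsilon+\alpha}(Z)\text{ for all radii }\epsilon\in[0,\epsilon_R]\}$, where $\beta_0^{\epsilon+\alpha}$ denotes the Betti number at radius $\epsilon+\alpha$ (even if this exceeds $\epsilon_R$). A correspondence between metric spaces $(Z,d_Z)$ and $(Z',d_{Z'})$ is a relation $f\subset Z\times Z'$ such that every element of $Z$ is related to some element of $Z'$ and vice versa. Its distortion is $\operatorname{dis}(f)=\sup\{|d_Z(\mathbf{z}_1,\mathbf{z}_2)-d_{Z'}(\mathbf{z}_1',\mathbf{z}_2')|:(\mathbf{z}_1,\mathbf{z}_1'),(\mathbf{z}_2,\mathbf{z}_2')\in f\}$, and $\operatorname{d_{GH}}(Z,Z')=\tfrac12\inf_f\operatorname{dis}(f)$ over all correspondences $f$. *)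

(* Defs.v *)
From HB Require Import structures.
From mathcomp Require Import all_boot all_order all_algebra.
From mathcomp Require Import finmap.
From mathcomp Require Import all_classical all_reals all_analysis.
Set Implicit Arguments.
Unset Strict Implicit.
Unset Printing Implicit Defensive.
Import Order.TTheory GRing.Theory Num.Theory.
Import numFieldNormedType.Exports.
Local Open Scope classical_set_scope.
Local Open Scope ring_scope.

(* The library norm on 'rV[R]_p is the max norm, hence this definition. *)
Definition enorm (R : realType) (p : nat) (v : 'rV[R]_p) : R :=
  Num.sqrt (\sum_(i < p) v ord0 i ^+ 2).

Definition edist (R : realType) (p : nat) (u v : 'rV[R]_p) : R := enorm (u - v).

(* p differential equations, with m control parameters,
     eqn i A t (X(A,t), X'(A,t), ..., X^(order)(A,t)) = 0,   i < p,
   possibly implicit, non-autonomous and of order higher than one; the last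
   argument of eqn maps k to the vector of k-th derivatives. *)
Record dynamical_system (R : realType) (m p : nat) := DynamicalSystem {
  ds_time : interval R;
  ds_order : nat;
  ds_eqn : 'I_p -> 'rV[R]_m -> R -> ('I_ds_order.+1 -> 'rV[R]_p) -> R
}.

(* The equations are imposed in the interior of the time interval, together with
   continuity on the whole interval, so that initial times may be endpoints.
   The state space is the union of the ranges of these solutions. *)
Definition solution (R : realType) (m p : nat) (X : dynamical_system R m p)
    (A : 'rV[R]_m) (x : R -> 'rV[R]_p) : Prop :=
  [/\ forall i : 'I_p,
        {within [set` ds_time X], continuous (fun t => x t ord0 i : R)},
      forall (i : 'I_p) (k : nat) (t : R),
        (k < ds_order X)%N -> (interior [set` ds_time X]) t ->
        derivable (derive1n k (fun s => x s ord0 i : R)) t 1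
    & forall (i : 'I_p) (t : R), (interior [set` ds_time X]) t ->
        ds_eqn i A t
          (fun k : 'I_(ds_order X).+1 =>
             \row_(j < p) derive1n k (fun s => x s ord0 j : R) t) = 0].

Definition trajectory (R : realType) (p T : nat) (x : R -> 'rV[R]_p)
    (t : 'I_T -> R) : {fset 'rV[R]_p} :=
  [fset x (t n) | n : 'I_T]%fset.

Definition neighboring (R : realType) (p : nat) (delta t0 : R)
    (x y : R -> 'rV[R]_p) : Prop :=
  edist (x t0) (y t0) <= delta.

Definition rips (R : realType) (p : nat) (Z : {fset 'rV[R]_p}) (e : R) :
    {set {set Z}} :=
  [set s : {set Z} |
    [forall z1 in s, forall z2 in s, edist (val z1) (val z2) <= 2 * e]]%SET.

(* Simplicial homology in degree 0 with coefficients in F. *)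
Section Homology0.
Context (F : fieldType) (V : finType).
Implicit Types K L : {set {set V}}.

Definition chain0 (x : V) : {ffun V -> F^o} := [ffun y => (y == x)%:R].

Definition C0 K : {vspace {ffun V -> F^o}} :=
  (\sum_(x : V | [set x]%SET \in K) <[chain0 x]>)%VS.

(* The pairs with x = y contribute the zero boundary. *)
Definition B0 K : {vspace {ffun V -> F^o}} :=
  (\sum_(xy : V * V | [set xy.1; xy.2]%SET \in K)
     <[chain0 xy.2 - chain0 xy.1]>)%VS.

(* For K \subset L, the rank of the map H_0(K) -> H_0(L) induced by the
   inclusion: its image is (C_0(K) + B_0(L)) / B_0(L). *)
Definition persistent_betti0 K L : nat := (\dim (C0 K + B0 L) - \dim (B0 L))%N.

End Homology0.

(* 0-dimensional barcode of the Vietoris-Rips filtration of Z. With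
   r_1 < ... < r_n the radii at which the complex may change, and the filtration
     K_0 = set0, K_i = rips Z r_i for 1 <= i <= n,
   the multiplicities of [r_i, r_j) and of [r_i, +oo) are
     (b_{i,j-1} - b_{i,j}) - (b_{i-1,j-1} - b_{i-1,j})  and
     b_{i,n} - b_{i-1,n},
   where b_{i,j} is the rank of H_0(K_i) -> H_0(K_j). *)
Section Barcode0.
Context (F : fieldType) (R : realType) (p : nat) (Z : {fset 'rV[R]_p}).

Definition critical_radii : seq R :=
  sort <=%R
    (undup [seq edist u v / 2 | u <- enum_fset Z, v <- enum_fset Z]).

Definition radius (i : nat) : R := nth 0 critical_radii i.-1.

Definition stage (i : nat) : {set {set Z}} :=
  if i is 0 then finset.set0 else rips Z (radius i).

Definition pbetti (i j : nat) : nat := persistent_betti0 F (stage i) (stage j).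

Definition bar_mult (i j : nat) : nat :=
  ((pbetti i j.-1 - pbetti i j) - (pbetti i.-1 j.-1 - pbetti i.-1 j))%N.

Definition bar_mult_oo (i : nat) : nat :=
  (pbetti i (size critical_radii) - pbetti i.-1 (size critical_radii))%N.

(* (b, d) stands for [b, d). *)
Definition barcode0 : seq (R * \bar R) :=
  let n := size critical_radii in
  flatten [seq nseq (bar_mult i j) (radius i, (radius j)%:E)
            | i <- iota 1 n, j <- iota i.+1 (n - i)]
  ++ flatten [seq nseq (bar_mult_oo i) (radius i, +oo%E) | i <- iota 1 n].

Definition betti0 (e : R) : nat :=
  count (fun I : R * \bar R => (I.1 <= e) && (e%:E < I.2)%E) barcode0.

End Barcode0.

Definition interleaving_distance (R : realType) (eR : R) (b b' : R -> nat) : R :=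
  inf [set a : R | 0 < a /\
        forall e : R, 0 <= e <= eR ->
          (b' (e + a)%R <= b e)%N /\ (b (e + a)%R <= b' e)%N].

Definition correspondence (S S' : Type) (f : set (S * S')) : Prop :=
  (forall z, exists z', f (z, z')) /\ (forall z', exists z, f (z, z')).

(* Real suprema and infima: meaningful for bounded nonempty metric spaces. *)
Definition distortion (R : realType) (S S' : Type)
    (d : S -> S -> R) (d' : S' -> S' -> R) (f : set (S * S')) : R :=
  sup [set r : R | exists z1 z2 z1' z2',
        [/\ f (z1, z1'), f (z2, z2') & r = `|d z1 z2 - d' z1' z2'|]].

Definition gromov_hausdorff (R : realType) (S S' : Type)
    (d : S -> S -> R) (d' : S' -> S' -> R) : R :=
  2^-1 * inf [set distortion d d' f | f in @correspondence S S'].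

Definition edist_on (R : realType) (p : nat) (Z : {fset 'rV[R]_p}) (u v : Z) : R :=
  edist (val u) (val v).

Arguments betti0 F {R p} Z e.
Arguments edist_on {R p} Z u v.

(* Main.v *)
From Pilot Require Import Defs.
From HB Require Import structures.
From mathcomp Require Import all_boot all_order all_algebra.
From mathcomp Require Import finmap.
From mathcomp Require Import all_classical all_reals all_analysis.
Import Order.TTheory GRing.Theory Num.Theory.
Import numFieldNormedType.Exports.
Local Open Scope classical_set_scope.
Local Open Scope ring_scope.

(** Why the theorem holds.  In degree 0 every bar of a Vietoris-Rips filtration
    is born at the first critical radius, because all vertices are present from
    the start.  The barcode count at a radius [e >= 0] is therefore a telescoping
    sum of ranks, equal to the dimension of [H_0] of the complex at [e], that is,
    to the codimension of the space of boundaries in the space of 0-chains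
    ([betti0E]).

    Let [f] be a correspondence of distortion [D], and let [a > 0] with
    [D <= 2 a].  Any vertex map [phi] contained in [f] lengthens distances by at
    most [2 a], so it sends edges of the complex of [Z] at [e] to edges of the
    complex of [Z'] at [e + a]: this is where the factor 2 in the definition of
    the complex turns distortion into half-distortion.  Moreover every vertex
    [z'] of [Z'] is related to some [z], and [phi z], being related to that same
    [z], lies within [2 a <= 2 (e + a)] of [z'].  So [phi] induces a surjection
    on [H_0], and the Betti number of [Z'] at [e + a] is at most that of [Z] at
    [e] ([betti0_correspondence]).

    The converse correspondence gives the other inequality, so the interleaving
    distance is at most [D / 2].  The infimum over [f] bounds it by the
    Gromov-Hausdorff distance itself
    ([interleaving_distance_le_gromov_hausdorff]), which is nonnegative and
    hence at most its double.  The range of the Betti curves is [[0, 2T]]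
    because a cloud made of two trajectories has at most [2T] points. *)

(* [edist] also names an extended distance, and [radius] that of a ball. *)
Local Notation edist := Pilot.Defs.edist.
Local Notation radius := Pilot.Defs.radius.

(** * Chain maps and H_0 of complexes containing all vertices *)

Section ChainMaps.
Context {F : fieldType} {V W : finType} (phi : V -> W).

Definition pushforward (v : {ffun V -> F^o}) : {ffun W -> F^o} :=
  \sum_(x : V) v x *: chain0 F (phi x).

Fact pushforward_is_linear : linear pushforward.
Proof.
move=> a u v; rewrite /pushforward scaler_sumr -big_split /=.
by apply: eq_bigr => x _; rewrite !ffunE scalerDl -scalerA.
Qed.

HB.instance Definition _ :=
  GRing.isLinear.Build F {ffun V -> F^o} {ffun W -> F^o} _ pushforward
    pushforward_is_linear.

Lemma pushforward_chain0 x : pushforward (chain0 F x) = chain0 F (phi x).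
Proof.
rewrite /pushforward (bigD1 x) //= big1 ?addr0 => [|y /negPf nyx].
  by rewrite ffunE eqxx scale1r.
by rewrite ffunE nyx scale0r.
Qed.

End ChainMaps.

Section VertexComplexes.
Context {F : fieldType}.

(** The point masses generate the 0-chains. *)
Lemma fullv_chain0 (V : finType) (U : {vspace {ffun V -> F^o}}) :
  (forall x, chain0 F x \in U) -> U = fullv.
Proof.
move=> UT; apply/eqP; rewrite eqEsubv subvf /=; apply/subvP => v _.
have -> : v = \sum_(x : V) v x *: chain0 F x.
  apply/ffunP => y; rewrite sum_ffunE (bigD1 y) //= big1 ?addr0 => [|x /negPf nxy].
    by rewrite !ffunE eqxx; exact/esym/mulr1.
  by rewrite !ffunE eq_sym nxy; exact: mulr0.
by apply: memv_suml => x _; apply: memvZ.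
Qed.

Lemma C0_full (V : finType) (K : {set {set V}}) :
  (forall x, [set x]%SET \in K) -> C0 F K = fullv.
Proof.
move=> KV; apply: fullv_chain0 => x.
by apply: (subvP (sumv_sup x (KV x) (subvv _))); apply: memv_line.
Qed.

Lemma dim_chains_le (V : finType) : (\dim {:{ffun V -> F^o}} <= #|V|)%N.
Proof.
rewrite -(@C0_full V [set: {set V}]%SET) => [|x]; last by rewrite finset.in_setT.
apply: leq_trans (dimv_leq_sum _ _ _) _.
apply: (@leq_trans (\sum_(x : V | [set x]%SET \in [set: {set V}]%SET) 1)%N).
  by apply: leq_sum => x _; rewrite dim_vline leq_b1.
by rewrite sum1_card max_card.
Qed.

Lemma B0_edge {V : finType} (K : {set {set V}}) x y :
  [set x; y]%SET \in K -> chain0 F y - chain0 F x \in B0 F K.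
Proof.
move=> Kxy; apply: (subvP (sumv_sup (x, y) Kxy (subvv _))); apply: memv_line.
Qed.

Lemma B0_subset (V : finType) (K L : {set {set V}}) :
  K \subset L -> (B0 F K <= B0 F L)%VS.
Proof.
move=> KL; apply/subv_sumP => xy Kxy.
by rewrite -memvE; apply: B0_edge; apply: (fintype.subsetP KL).
Qed.

(** The dimension of [H_0] for a complex that contains all vertices, so that
    its 0-chains are all the functions on [V]. *)
Definition dim_H0 {V : finType} (K : {set {set V}}) : nat :=
  (\dim {:{ffun V -> F^o}} - \dim (B0 F K))%N.

(** When all vertices are already in [K], the map from [H_0] of [K] to that of
    [L] is onto, so its rank depends on [L] alone; this makes every barcode
    multiplicity except those of the first birth radius vanish. *)
Lemma persistent_betti0_dim_H0 (V : finType) (K L : {set {set V}}) :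
  (forall x, [set x]%SET \in K) -> persistent_betti0 F K L = dim_H0 L.
Proof. by move=> KV; rewrite /persistent_betti0 C0_full // (addv_idPl (subvf _)). Qed.

Lemma persistent_betti0_set0 (V : finType) (L : {set {set V}}) :
  persistent_betti0 F finset.set0 L = 0%N.
Proof.
rewrite /persistent_betti0 /C0 big1 ?add0v ?subnn // => x.
by rewrite finset.in_set0.
Qed.

Lemma dim_H0_subset {V : finType} (K L : {set {set V}}) :
  K \subset L -> (dim_H0 L <= dim_H0 K)%N.
Proof. by move=> KL; rewrite leq_sub2l // dimvS // B0_subset. Qed.

(** A simplicial map whose image meets every connected component, through at
    most one edge, is onto on [H_0].  In codimensions: a complement of the
    boundaries of [K] is mapped onto the chains of [W] modulo the boundaries of
    [L]. *)
Lemma dim_H0_surj {V W : finType} (K : {set {set V}}) (L : {set {set W}})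
    (phi : V -> W) :
  (forall x y, [set x; y]%SET \in K -> [set phi x; phi y]%SET \in L) ->
  (forall z, exists x, [set phi x; z]%SET \in L) ->
  (dim_H0 L <= dim_H0 K)%N.
Proof.
move=> phi_simpl phi_onto; pose f := linfun (@pushforward F V W phi).
have fE x : f (chain0 F x) = chain0 F (phi x).
  by rewrite lfunE /= pushforward_chain0.
have fB : (f @: B0 F K <= B0 F L)%VS.
  rewrite limg_sum; apply/subv_sumP => -[x y] /= Kxy.
  by rewrite limg_line -memvE linearB /= !fE; apply/B0_edge/phi_simpl.
have full : (f @: (B0 F K)^C + B0 F L)%VS = fullv.
  apply: fullv_chain0 => z; have [x Lxz] := phi_onto z.
  rewrite -[chain0 F z](subrK (chain0 F (phi x))) -fE addrC.
  apply: (subvP (_ : f @: fullv + B0 F L <= _)%VS).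
    rewrite -(addv_complf (B0 F K)) limgD -addvA subv_add subvv andbT.
    exact: subv_trans fB (addvSr _ _).
  by rewrite memv_add ?memv_img ?memvf // fE B0_edge.
rewrite /dim_H0 -full leq_subLR addnC.
apply: leq_trans (dimv_add_leqif _ _) _.
by rewrite leq_add2r -dimv_compl -(limg_ker_dim f (B0 F K)^C) leq_addl.
Qed.

End VertexComplexes.

(** * The barcode of the Vietoris-Rips filtration *)

(** Truncated subtractions are genuine here because [c] does not increase on the
    interval; the final [c n] stands for the bars that never die. *)
Lemma telescope_subn (c : nat -> nat) k n : (k <= n)%N ->
  (forall i, (k <= i < n)%N -> (c i.+1 <= c i)%N) ->
  (\sum_(k <= i < n) (c i - c i.+1) + c n)%N = c k.
Proof.
elim: n => [|n IHn]; first by rewrite leqn0 => /eqP ->; rewrite big_geq.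
rewrite leq_eqVlt => /predU1P[-> _|]; first by rewrite big_geq.
rewrite ltnS => kn cle; rewrite big_nat_recr //= -addnA subnK; last first.
  by rewrite cle // kn ltnSn.
by apply: IHn => // i /andP[ki iN]; rewrite cle // ki ltnS ltnW.
Qed.

Section EuclideanDistance.
Context {R : realType} {p : nat}.
Implicit Types u v : 'rV[R]_p.

Lemma edist_ge0 u v : 0 <= edist u v.
Proof. exact: sqrtr_ge0. Qed.

Lemma edistxx u : edist u u = 0.
Proof.
by rewrite /edist /enorm subrr big1 ?sqrtr0 // => i _; rewrite mxE expr0n.
Qed.

Lemma edistC u v : edist u v = edist v u.
Proof.
rewrite /edist /enorm -opprB; congr Num.sqrt; apply: eq_bigr => i _.
by rewrite mxE sqrrN.
Qed.

End EuclideanDistance.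

Section Rips.
Context {R : realType} {p : nat} (Z : {fset 'rV[R]_p}).

(** The condition on the simplex also concerns the distance from each vertex to
    itself, whence the nonnegative radius. *)
Lemma rips_edge (u v : Z) e : 0 <= e ->
  ([set u; v]%SET \in rips Z e) = (edist (val u) (val v) <= 2 * e).
Proof.
move=> e0; have e20 : 0 <= 2 * e by rewrite mulr_ge0.
rewrite inE; apply/idP/idP => [/forall_inP/(_ u)|uv].
  by rewrite !inE eqxx => /(_ isT)/forall_inP/(_ v); rewrite !inE eqxx orbT; apply.
apply/forall_inP => a; rewrite !inE => /orP[] /eqP ->; apply/forall_inP => b;
  by rewrite !inE => /orP[] /eqP ->; rewrite ?edistxx // edistC.
Qed.

Lemma rips_vertex (u : Z) e : 0 <= e -> [set u]%SET \in rips Z e.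
Proof. by move=> e0; rewrite -[[set u]%SET]finset.setUid rips_edge // edistxx mulr_ge0. Qed.

Lemma rips_subset e e' : e <= e' -> rips Z e \subset rips Z e'.
Proof.
move=> ee'; apply/fintype.subsetP => s; rewrite !inE => /forall_inP se.
apply/forall_inP => u us; apply/forall_inP => v vs.
by apply: le_trans (forall_inP (se u us) v vs) _; rewrite ler_pM2l.
Qed.

End Rips.

Section Barcode.
Context {F : fieldType} {R : realType} {p : nat} (Z : {fset 'rV[R]_p}).
Let s := critical_radii Z.
Let n := size s.

Lemma critical_radii_mem (u v : Z) : edist (val u) (val v) / 2 \in s.
Proof.
rewrite mem_sort mem_undup; apply/allpairsP; exists (val u, val v).
by split => //=; apply: valP.
Qed.

Lemma sorted_critical_radii : sorted <=%R s.
Proof. exact/sort_sorted/le_total. Qed.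

Lemma radius_ge0 i : 0 <= radius Z i.
Proof.
rewrite /radius; have [is_|] := ltnP i.-1 n; last by move=> ?; rewrite nth_default.
have := mem_nth 0 is_; rewrite mem_sort mem_undup => /allpairsP[[u v] [_ _ ->]] /=.
by rewrite divr_ge0 // edist_ge0.
Qed.

Lemma radius_le i j : (0 < i <= j)%N -> (j <= n)%N -> radius Z i <= radius Z j.
Proof.
case: i j => [|i] [|j] //= ij jn.
by apply: (sorted_leq_nth le_trans le_refl 0 sorted_critical_radii);
  rewrite ?inE //; apply: leq_ltn_trans jn.
Qed.

(** The complex at [e] is the one at the largest critical radius not exceeding
    [e]; as radii are numbered from 1, its number is the count of these
    radii. *)
Lemma rips_radius e (k := count (<= e) s) : (0 < k)%N -> rips Z e = rips Z (radius Z k).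
Proof.
move=> k0; have kn : (k.-1 < n)%N by rewrite prednK // count_size.
have ke : radius Z k <= e.
  by apply: nth_count_le sorted_critical_radii _; rewrite prednK.
apply/eqP; rewrite finset.eqEsubset (rips_subset Z _ _ ke) andbT.
apply/fintype.subsetP => t; rewrite !inE => /forall_inP te.
apply/forall_inP => u ut; apply/forall_inP => v vt.
have half r : (edist (val u) (val v) <= 2 * r) = (edist (val u) (val v) / 2 <= r).
  by rewrite ler_pdivrMr // mulrC.
have := forall_inP (te u ut) v vt; rewrite !half.
have [i iN <-] := nthP 0 (critical_radii_mem u v).
have [ik _|ki] := ltnP i k; last first.
  by rewrite leNgt (nth_count_gt _ sorted_critical_radii) // ki.
apply: (sorted_leq_nth le_trans le_refl 0 sorted_critical_radii);
  by rewrite ?inE // -ltnS prednK.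
Qed.

Lemma pbettiE i j : (0 < i)%N -> pbetti F Z i j = dim_H0 (F := F) (stage Z j).
Proof.
case: i => // i _; apply: persistent_betti0_dim_H0 => x.
by apply: rips_vertex; apply: radius_ge0.
Qed.

Lemma pbetti0 j : pbetti F Z 0 j = 0%N.
Proof. exact: persistent_betti0_set0. Qed.

(** Only the bars born at the first radius have nonzero multiplicity, and the
    multiplicity of a death at radius [j] is the drop of [dim H_0] from stage
    [j.-1] to stage [j].  Those alive at [e] die after stage [k], the stage of
    [e], or never: the drops after [k] plus the final dimension telescope to the
    dimension at stage [k]. *)
Lemma betti0E e : 0 <= e -> (0 < #|` Z|)%N ->
  betti0 F Z e = dim_H0 (F := F) (rips Z e).
Proof.
move=> e0 Zn0; pose k := count (<= e) s.
pose c j := dim_H0 (F := F) (stage Z j).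
have k0 : (0 < k)%N.
  (* The distance from a point to itself makes 0 a critical radius. *)
  have /card_gt0P[u _] : (0 < #|{: Z}|)%N by rewrite -cardfE.
  rewrite -has_count; apply/hasP; exists (edist (val u) (val u) / 2).
    exact: critical_radii_mem.
  by rewrite /= edistxx mul0r.
have kn : (k <= n)%N := count_size _ _.
have n0 : (0 < n)%N := leq_trans k0 kn.
have mult1 j : bar_mult F Z 1 j = (c j.-1 - c j)%N.
  by rewrite /bar_mult /= !pbetti0 !pbettiE // !subn0.
have mult_gt1 i j : (1 < i)%N -> bar_mult F Z i j = 0%N.
  by case: i => [|[|i]] // _; rewrite /bar_mult !pbettiE // subnn.
have mult1oo : bar_mult_oo F Z 1 = c n.
  by rewrite /bar_mult_oo /= !pbetti0 !pbettiE // subn0.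
have multoo_gt1 i : (1 < i)%N -> bar_mult_oo F Z i = 0%N.
  by case: i => [|[|i]] // _; rewrite /bar_mult_oo !pbettiE // subnn.
have iota1 : iota 1 n = 1%N :: iota 2 n.-1 by rewrite -[in LHS](prednK n0).
have r1 : radius Z 1 <= e by apply: nth_count_le sorted_critical_radii _.
rewrite rips_radius // -/k.
transitivity (c k); last by rewrite /c; case: (k) k0.
rewrite /betti0 /barcode0 -/s -/n count_cat !count_flatten !sumnE !big_map.
rewrite big_allpairs_dep iota1 !big_cons /=.
rewrite [X in (_ + X + _)%N]big1_seq ?addn0; last first.
  move=> i /andP[_]; rewrite mem_iota => /andP[i1 _]; apply: big1 => j _.
  by rewrite count_nseq mult_gt1 // muln0.
rewrite [X in (_ + (_ + X))%N]big1_seq ?addn0; last first.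
  move=> i /andP[_]; rewrite mem_iota => /andP[i1 _].
  by rewrite count_nseq multoo_gt1 // muln0.
rewrite mult1oo count_nseq /= r1 ltry mul1n.
have -> : iota 2 (n - 1) = index_iota 2 n.+1 by rewrite /index_iota subSS.
(* Deaths up to stage [k] occur at radii at most [e] and do not count. *)
rewrite big_add1 /= (big_cat_nat k0 kn) /= big_nat big1 ?add0n; last first.
  move=> i /andP[i1 ik]; rewrite count_nseq /= r1 lte_fin ltNge.
  by rewrite (nth_count_le _ sorted_critical_radii).
rewrite big_nat (eq_bigr (fun i => c i - c i.+1)%N) -?big_nat; last first.
  move=> i /andP[ki iN]; rewrite count_nseq /= r1 lte_fin mult1.
  by rewrite (nth_count_gt _ sorted_critical_radii) ?ki // mul1n.
apply: telescope_subn => // i /andP[ki iN].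
have i0 := leq_trans k0 ki; apply: dim_H0_subset.
by case: i i0 {ki} iN => // i _ iN; apply/rips_subset/radius_le => //=.
Qed.

End Barcode.

(** * Correspondences and the stability inequality *)

Section Correspondences.
Context {R : realType} {S S' : finType} (d : S -> S -> R) (d' : S' -> S' -> R).
Context {f : set (S * S')}.

(** The supremum is that of a finite set of numbers, all bounded by their sum
    over every quadruple; unbounded sets would have supremum 0. *)
Lemma distortion_ub {z1 z2 z1' z2'} : f (z1, z1') -> f (z2, z2') ->
  `|d z1 z2 - d' z1' z2'| <= distortion d d' f.
Proof.
move=> f1 f2; apply: ub_le_sup; last by exists z1, z2, z1', z2'.
pose g (q : S * S * S' * S') := `|d q.1.1.1 q.1.1.2 - d' q.1.2 q.2|.
exists (\sum_q g q) => _ [u1 [u2 [u1' [u2' [_ _ ->]]]]].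
rewrite (bigD1 (u1, u2, u1', u2')) //= lerDl.
by apply: sumr_ge0 => q _; apply: normr_ge0.
Qed.

Lemma distortion_ge0 : (0 < #|S|)%N -> correspondence f ->
  0 <= distortion d d' f.
Proof.
move=> /card_gt0P[z _] [/(_ z)[z' fzz'] _]; apply: le_trans (distortion_ub fzz' fzz').
exact: normr_ge0.
Qed.

Lemma correspondence_sym : correspondence f -> correspondence [set q | f (q.2, q.1)].
Proof. by case. Qed.

End Correspondences.

Section GromovHausdorff.
Context {R : realType} {S S' : finType} (d : S -> S -> R) (d' : S' -> S' -> R).
Context (S_gt0 : (0 < #|S|)%N) (S'_gt0 : (0 < #|S'|)%N).

(** The total relation is a correspondence between nonempty sets. *)
Lemma distortions_nonempty :
  [set distortion d d' f | f in @correspondence S S'] !=set0.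
Proof.
have [z _] := card_gt0P S_gt0; have [z' _] := card_gt0P S'_gt0.
by exists (distortion d d' setT), setT => //; split=> u; [exists z'|exists z].
Qed.

Lemma gromov_hausdorff_ge0 : 0 <= gromov_hausdorff d d'.
Proof.
rewrite mulr_ge0 ?invr_ge0 //; apply: lb_le_inf distortions_nonempty _.
by move=> _ [f fcorr <-]; apply: distortion_ge0.
Qed.

End GromovHausdorff.

Section Stability.
Context {F : fieldType} {R : realType} {p : nat}.
Implicit Types Z : {fset 'rV[R]_p}.

(** A vertex map chosen inside the correspondence induces a surjection on [H_0]
    from radius [e] to radius [e + a]. *)
Lemma betti0_correspondence Z Z' (f : set (Z * Z')) a e :
  (0 < #|` Z|)%N -> (0 < #|` Z'|)%N -> correspondence f -> 0 <= a -> 0 <= e ->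
  (forall z1 z2 z1' z2', f (z1, z1') -> f (z2, z2') ->
     `|edist_on Z z1 z2 - edist_on Z' z1' z2'| <= 2 * a) ->
  (betti0 F Z' (e + a) <= betti0 F Z e)%N.
Proof.
move=> Z0 Z'0 [ftot fsurj] a0 e0 fdis; have ea0 : 0 <= e + a by rewrite addr_ge0.
have [phi fphi] := choice ftot.
rewrite !betti0E //; apply: (dim_H0_surj _ _ phi) => [u v | z'].
  rewrite !rips_edge // mulrDr => uv.
  have := fdis _ _ _ _ (fphi u) (fphi v); rewrite distrC.
  by move=> /ler_distlDr/le_trans; apply; rewrite lerD2r.
(* Both [phi z] and [z'] are related to [z], so their distance is a distortion. *)
have [z fzz'] := fsurj z'; exists z; rewrite rips_edge // mulrDr.
have := fdis _ _ _ _ (fphi z) fzz'; rewrite {1}/edist_on edistxx distrC subr0.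
move=> /(le_trans (ler_norm _))/le_trans; apply.
by rewrite lerDr mulr_ge0.
Qed.

Lemma betti0_le_card Z e : (0 < #|` Z|)%N -> 0 <= e -> (betti0 F Z e <= #|` Z|)%N.
Proof.
move=> Z0 e0; rewrite betti0E // cardfE.
exact: leq_trans (leq_subr _ _) (dim_chains_le _).
Qed.

(** Each [D / 2 + c] with [c > 0] is an interleaving parameter; the slack [c] is
    needed because parameters are positive while [D] may be 0. *)
Lemma interleaving_distance_le_distortion Z Z' (f : set (Z * Z')) eR :
  (0 < #|` Z|)%N -> (0 < #|` Z'|)%N -> correspondence f ->
  interleaving_distance eR (betti0 F Z) (betti0 F Z')
    <= distortion (edist_on Z) (edist_on Z') f / 2.
Proof.
move=> Z0 Z'0 fcorr; set D := distortion _ _ _.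
have D0 : 0 <= D.
  by apply: distortion_ge0 fcorr; rewrite -cardfE.
apply/ler_addgt0Pr => c c0; apply: ge_inf; first by exists 0 => a [/ltW].
have a0 : 0 < D / 2 + c by rewrite ltr_wpDl // divr_ge0.
split=> // e /andP[e0 _].
have fdis z1 z2 z1' z2' : f (z1, z1') -> f (z2, z2') ->
    `|edist_on Z z1 z2 - edist_on Z' z1' z2'| <= 2 * (D / 2 + c).
  move=> f1 f2; apply: le_trans (distortion_ub _ _ f1 f2) _.
  by rewrite mulrDr mulrC divfK // lerDl mulr_ge0 // ltW.
split; first exact: betti0_correspondence fcorr (ltW a0) e0 fdis.
apply: betti0_correspondence (correspondence_sym fcorr) (ltW a0) e0 _ => //.
by move=> z1 z2 z1' z2' f1 f2; rewrite distrC; apply: fdis.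
Qed.

Lemma interleaving_distance_le_gromov_hausdorff Z Z' eR :
  (0 < #|` Z|)%N -> (0 < #|` Z'|)%N ->
  interleaving_distance eR (betti0 F Z) (betti0 F Z')
    <= gromov_hausdorff (edist_on Z) (edist_on Z').
Proof.
move=> Z0 Z'0; rewrite /gromov_hausdorff ler_pdivlMl // mulrC.
apply: lb_le_inf; first by apply: distortions_nonempty; rewrite -cardfE.
move=> _ [f fcorr <-]; rewrite -ler_pdivlMr //.
exact: interleaving_distance_le_distortion.
Qed.

End Stability.

(** * Pairs of trajectories *)

Lemma card_trajectoryU (R : realType) (p T : nat) (x y : R -> 'rV[R]_p)
    (t : 'I_T -> R) :
  (#|` (trajectory x t `|` trajectory y t)%fset| <= 2 * T)%N.
Proof.
have card_traj (z : R -> 'rV[R]_p) : (#|` trajectory z t| <= T)%N.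
  by apply: (leq_trans (leq_imfset_card _ _ _)); rewrite -[leqRHS]card_ord cardE.
by rewrite cardfsU (leq_trans (leq_subr _ _)) // mul2n -addnn leq_add.
Qed.

Lemma trajectoryU_gt0 (R : realType) (p T : nat) (x y : R -> 'rV[R]_p)
    (t : 'I_T -> R) : (0 < T)%N ->
  (0 < #|` (trajectory x t `|` trajectory y t)%fset|)%N.
Proof.
move=> T0; rewrite cardfs_gt0; apply/fset0Pn; exists (x (t (Ordinal T0))).
by rewrite in_fsetU; apply/orP; left; apply: in_imfset.
Qed.

Theorem theorem17 (F : fieldType) (R : realType) (m p : nat)
    (X : dynamical_system R m p) (A : 'rV[R]_m)
    (T : nat) (T_gt0 : (0 < T)%N) (t : 'I_T -> R)
    (t_time : forall n : 'I_T, t n \in ds_time X)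
    (x y x' y' : R -> 'rV[R]_p)
    (x_sol : solution X A x) (y_sol : solution X A y)
    (x'_sol : solution X A x') (y'_sol : solution X A y')
    (delta delta' : R) (delta_gt0 : 0 < delta) (delta'_gt0 : 0 < delta')
    (xy_neighboring : neighboring delta (t (Ordinal T_gt0)) x y)
    (x'y'_neighboring : neighboring delta' (t (Ordinal T_gt0)) x' y')
    (N : nat) (eps : 'I_N.+1 -> R) (eps_0 : eps ord0 = 0)
    (eps_incr : forall i j : 'I_N.+1, (i < j)%N -> eps i < eps j) :
  let Z := (trajectory x t `|` trajectory y t)%fset in
  let Z' := (trajectory x' t `|` trajectory y' t)%fset in
  (forall e : R, 0 <= e <= eps ord_max ->
     (betti0 F Z e <= 2 * T)%N /\ (betti0 F Z' e <= 2 * T)%N) /\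
  interleaving_distance (eps ord_max) (betti0 F Z) (betti0 F Z')
    <= 2 * gromov_hausdorff (edist_on Z) (edist_on Z').
Proof.
move=> Z Z'.
have Z0 : (0 < #|` Z|)%N by apply: trajectoryU_gt0.
have Z'0 : (0 < #|` Z'|)%N by apply: trajectoryU_gt0.
split=> [e /andP[e0 _] | ].
  by split; apply: leq_trans (betti0_le_card _ _ _ _) _ => //;
    apply: card_trajectoryU.
apply: le_trans (interleaving_distance_le_gromov_hausdorff _ _ _ Z0 Z'0) _.
by rewrite ler_peMl ?ler1n // gromov_hausdorff_ge0 // -cardfE.
Qed.
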